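(* Let $\mathcal{U}$ be a space of control signals, let $(X,d_X)$ be a Polish metric space, and let $p\colon \mathcal{U}\times X\to X$ be a path action of $\mathcal{U}$ on $X$. For $(\bar u,x)\in\mathcal{U}\times X$ define $\bar p(\bar u,x)\colon[0,|\bar u|]\to X$ by $\bar p(\bar u,x)(t)=p(\bar u_{<t},x)$ for $0\le t\le|\bar u|$. Then $\bar p$ is a continuous map $\bar p\colon \mathcal{U}\times X\to\mathcal{X}$, where $\mathcal{X}$ is the space of continuous trajectories in $X$.
   Context: Control signals. Let $U$ be a nonempty set and let $U^*$ be the set of all functions $\bar u\colon[0,T)\to U$ with $T\in\mathbb{R}_{\ge 0}$ (for $T=0$ this is the empty function $\varnothing$). Write $|\bar u|=T$. For $t\in\mathbb{R}_{\ge0}$, $\bar u_{<t}$ is the restriction of $\bar u$ to $[0,t)$ (equal to $\bar u$ if $t\ge|\bar u|$), and $\bar u_{\ge t}$ is the final segment, i.e. the function with domain $[0,|\bar u|-t)$ (empty if $t\ge|\bar u|$) given by $s\mapsto\bar u(t+s)$. Write $\bar u_1\lhd\bar u_2$ if $|\bar u_1|<|\bar u_2|$ and $(\bar u_2)_{<|\bar u_1|}=\bar u_1$. A space of control signals is a nonempty subset $\mathcal{U}\subseteq U^*$ that is (i) closed under segmentation: for all $\bar u\in\mathcal{U}$ and $t\ge0$, $\bar u_{<t},\bar u_{\ge t}\in\mathcal{U}$; (ii) extensive: for every $\bar u\in\mathcal{U}$ there is $\bar u_1\in\mathcal{U}$ with $\bar u\lhd\bar u_1$ and $|\bar u_1|\ge|\bar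 u|+1$; and (iii) equipped with a topology for which $\mathcal{U}\to\mathbb{R}_{\ge0}$, $\bar u\mapsto|\bar u|$, and $\mathcal{U}\times\mathbb{R}_{\ge0}\to\mathcal{U}$, $(\bar u,t)\mapsto\bar u_{<t}$, are continuous. Path action. A path action of $\mathcal{U}$ on $X$ is a continuous function $p\colon\mathcal{U}\times X\to X$ such that $p(\varnothing,x)=x$ for all $x\in X$, and $p(\bar u,x)=p(\bar u_{\ge t},p(\bar u_{<t},x))$ for all $x\in X$, $\bar u\in\mathcal{U}$, $t\in\mathbb{R}_{\ge0}$. Trajectories. $\mathcal{X}=\bigcup_{T\in\mathbb{R}_{\ge0}}C([0,T],X)$, with distance $$\varrho_{\mathcal{X}}(\bar x_1,\bar x_2)=\sup\{d_X(\bar x_1(t),\bar x_2(t))\mid t\in[0,\min\{T_1,T_2\}]\}+|T_2-T_1|$$ for $\bar x_i\colon[0,T_i]\to X$; the topology on $\mathcal{X}$ is the one generated by the open balls $\{\bar x\mid\varrho_{\mathcal{X}}(\bar x,\bar x_0)<\varepsilon\}$. *)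

(* Defs.v *)
From HB Require Import structures.
From mathcomp Require Import all_boot all_order all_algebra.
From mathcomp Require Import all_classical all_reals all_analysis.

Set Implicit Arguments.
Unset Strict Implicit.
Unset Printing Implicit Defensive.

Import Order.TTheory GRing.Theory Num.Theory.
Import numFieldNormedType.Exports.

Local Open Scope classical_set_scope.
Local Open Scope ring_scope.

(* [set_type] carries the subspace (initial) topology. *)
Notation Rge0 R := (set_type [set t : R | 0 <= t]).

Definition mkRge0 (R : realType) (t : R) (t0 : 0 <= t) : Rge0 R :=
  exist _ t (mem_set t0).

Lemma Rge0_ge0 (R : realType) (t : Rge0 R) : 0 <= \val t.
Proof. by case: t => t /= /set_mem. Qed.

Definition mkitv (R : realType) (i : interval R) (t : R) (ti : t \in i) :
  [set` i] := exist _ t (mem_set ti).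

Lemma itv_in (R : realType) (i : interval R) (t : [set` i]) : \val t \in i.
Proof. by case: t => t /= /set_mem. Qed.

Lemma itv_ge0 (R : realType) (T : R) (t : `[0, T]%classic) : 0 <= \val t.
Proof. by have := itv_in t; rewrite in_itv/= => /andP[]. Qed.

(* Signals have an intrinsic domain [0, T[, so Leibniz equality of signals is
   equality of partial functions. *)
Record signal (R : realType) (U : Type) := Signal {
  slen : Rge0 R;
  sfun : `[0, \val slen[%classic -> U }.

Section signal_operations.
Context {R : realType} {U : Type}.
Implicit Types (u : signal R U) (t : Rge0 R).

Lemma itv0_empty (T : R) : T = 0 -> `[0, T[%classic -> False.
Proof.
move=> -> s; have := itv_in s; rewrite in_itv/= => /andP[/le_lt_trans h /h].
by rewrite ltxx.
Qed.

Definition empty_signal : signal R U :=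
  @Signal R U (mkRge0 (lexx 0)) (fun s => False_rect U (itv0_empty erefl s)).

Lemma prefix_len_subproof u t : 0 <= Num.min (\val t) (\val (slen u)).
Proof. by rewrite le_min !Rge0_ge0. Qed.

Lemma prefix_subproof u t (s : `[0, Num.min (\val t) (\val (slen u))[%classic) :
  \val s \in `[0, \val (slen u)[.
Proof.
by have := itv_in s; rewrite !in_itv/= lt_min => /and3P[-> _ ->].
Qed.

Definition signal_prefix u t : signal R U :=
  @Signal R U (mkRge0 (prefix_len_subproof u t))
    (fun s => sfun (mkitv (prefix_subproof s))).

Lemma suffix_len_subproof u t : 0 <= Num.max (\val (slen u) - \val t) 0.
Proof. by rewrite le_max lexx orbT. Qed.

Lemma suffix_subproof u t
    (s : `[0, Num.max (\val (slen u) - \val t) 0[%classic) :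
  \val t + \val s \in `[0, \val (slen u)[.
Proof.
have := itv_in s; rewrite !in_itv/= => /andP[s0].
rewrite lt_max ltrBrDl => /orP[->|]; last by rewrite ltNge s0.
by rewrite addr_ge0 ?Rge0_ge0.
Qed.

Definition signal_suffix u t : signal R U :=
  @Signal R U (mkRge0 (suffix_len_subproof u t))
    (fun s => sfun (mkitv (suffix_subproof s))).

Definition strict_prefix u1 u2 :=
  \val (slen u1) < \val (slen u2) /\ signal_prefix u2 (slen u1) = u1.

Definition segmentation_closed (S : set (signal R U)) :=
  forall u t, S u -> S (signal_prefix u t) /\ S (signal_suffix u t).

Definition extensive (S : set (signal R U)) :=
  forall u, S u -> exists u1,
    [/\ S u1, strict_prefix u u1 & \val (slen u) + 1 <= \val (slen u1)].

Lemma signal_len0 u1 u2 :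
  \val (slen u1) = 0 -> \val (slen u2) = 0 -> u1 = u2.
Proof.
case: u1 u2 => [T1 f1] [T2 f2] /= T10 T20.
have T12 : T1 = T2.
  by apply: val_inj; exact: etrans T10 (esym T20).
case: T2 / T12 f2 T20 => f2 _; congr Signal; apply/funext => s.
by case: (itv0_empty T10 s).
Qed.

Lemma empty_signal_in (S : set (signal R U)) :
  S !=set0 -> segmentation_closed S -> S empty_signal.
Proof.
move=> [u Su] /(_ u (mkRge0 (lexx 0)) Su)[+ _].
congr (S _); apply: signal_len0 => //=.
by apply/min_idPl; exact: (Rge0_ge0 (slen u)).
Qed.

End signal_operations.

(* The topology is a structure on the subtype [T] of signals in [S]; no topology
   is put on the type of all signals. *)
HB.mixin Record isControlSpace (R : realType) (U : Type)
    (S : set (signal R U)) T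
    & Topological T & SubType (signal R U) (fun u => u \in S) T := {
  control_nonempty : S !=set0;
  control_segmentation : segmentation_closed S;
  control_extensive : extensive S;
  control_len_continuous : continuous (fun u : T => slen (\val u));
  control_prefix_continuous : continuous (fun ut : T * Rge0 R =>
    Sub (signal_prefix (\val ut.1) ut.2)
      (mem_set (proj1 (control_segmentation _ ut.2 (set_mem (valP ut.1))))) : T)
}.

#[short(type="controlSpaceType")]
HB.structure Definition ControlSpace (R : realType) (U : Type)
    (S : set (signal R U)) :=
  {T of isControlSpace R U S T & Topological T &
        SubType (signal R U) (fun u => u \in S) T}.

Section control_space.
Context {R : realType} {U : Type} {S : set (signal R U)}.
Variable calU : controlSpaceType S.
Implicit Types (u : calU) (t : Rge0 R).

Definition cempty : calU := Sub empty_signal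
  (mem_set (empty_signal_in (@control_nonempty _ _ _ calU)
                            (@control_segmentation _ _ _ calU))).

Definition clen u : Rge0 R := slen (\val u).

Definition cprefix u t : calU := Sub (signal_prefix (\val u) t)
  (mem_set (proj1 (@control_segmentation _ _ _ calU _ t (set_mem (valP u))))).

Definition csuffix u t : calU := Sub (signal_suffix (\val u) t)
  (mem_set (proj2 (@control_segmentation _ _ _ calU _ t (set_mem (valP u))))).

Definition path_action (X : topologicalType) (p : calU * X -> X) :=
  [/\ continuous p,
      forall x, p (cempty, x) = x &
      forall x u t, p (u, x) = p (csuffix u t, p (cprefix u t, x))].

End control_space.

Record trajectory (R : realType) (X : metricType R) := Trajectory {
  tlen : Rge0 R;
  tfun : `[0, \val tlen]%classic -> X;
  tfun_continuous : continuous tfun }.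

Section trajectory_topology.
Context {R : realType} {X : metricType R}.
Implicit Types x : trajectory X.

Lemma itv_minl_subproof (a b : R) (t : `[0, Num.min a b]%classic) :
  \val t \in `[0, a].
Proof. by have := itv_in t; rewrite !in_itv/= le_min => /and3P[-> ->]. Qed.

Lemma itv_minr_subproof (a b : R) (t : `[0, Num.min a b]%classic) :
  \val t \in `[0, b].
Proof. by have := itv_in t; rewrite !in_itv/= le_min => /and3P[-> _ ->]. Qed.

Definition traj_dist x1 x2 : R :=
  sup (range (fun t : `[0, Num.min (\val (tlen x1)) (\val (tlen x2))]%classic =>
    mdist (tfun (mkitv (itv_minl_subproof t)))
          (tfun (mkitv (itv_minr_subproof t)))))
  + `|\val (tlen x2) - \val (tlen x1)|.

Definition traj_ball (x0 : trajectory X) (e : R) : set (trajectory X) :=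
  [set x | traj_dist x x0 < e].

HB.instance Definition _ := gen_eqMixin (trajectory X).
HB.instance Definition _ := gen_choiceMixin (trajectory X).

(* [traj_dist] need not satisfy the triangle inequality, so it does not define
   a metric structure; the open balls are only used as a subbase. *)
HB.instance Definition _ := isSubBaseTopological.Build (trajectory X)
  [set B | exists x0 e, 0 < e /\ B = traj_ball x0 e] id.

End trajectory_topology.

(* Unlike [completeType], this does not force the space to be pointed. *)
Definition complete_space (X : uniformType) :=
  forall F : set_system X, ProperFilter F -> cauchy F -> exists x : X, F --> x.

Definition separable_space (X : topologicalType) :=
  exists2 D : set X, countable D & dense D.

Definition polish_metric (R : realType) (X : metricType R) :=
  complete_space X /\ separable_space X.

Definition path_trajectory (R : realType) (U : Type) (S : set (signal R U))
    (calU : controlSpaceType S) (X : Type) (p : calU * X -> X)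
    (u : calU) (x : X) (t : `[0, \val (clen u)]%classic) : X :=
  p (cprefix u (mkRge0 (itv_ge0 t)), x).

Arguments path_trajectory {R U S calU X} p u x t.

(* Main.v *)
(** Extend trajectories beyond their end by constants. The extension of
    [pbar(u, x)] is jointly continuous in [u], [x] and time. The distance from
    [pbar(u, x)] to a fixed trajectory [y] is then a supremum, over the compact
    interval on which [y] lives, of a function jointly continuous in
    [(u, x, t)], plus a continuous function of [|u|]. By the tube lemma it is
    upper semicontinuous in [(u, x)], so preimages of subbasic balls are open;
    no triangle inequality between trajectories is needed. *)

Require Import Defs.
From HB Require Import structures.
From mathcomp Require Import all_boot all_order all_algebra.
From mathcomp Require Import all_classical all_reals all_analysis.
From mathcomp Require Import lra.
Import Order.TTheory GRing.Theory Num.Theory.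
Import numFieldNormedType.Exports.
Local Open Scope classical_set_scope.
Local Open Scope ring_scope.

Lemma continuous_set_type (Z Y : topologicalType) (A : set Y)
    (g : Z -> set_type A) :
  continuous (fun z => \val (g z)) -> continuous g.
Proof. by move=> cg; exact: (@continuous_comp_initial _ _ _ set_val g cg). Qed.

Lemma continuous_set_val (Y : topologicalType) (A : set Y) :
  continuous (fun y : set_type A => \val y).
Proof. exact: (@initial_continuous _ _ set_val). Qed.

Lemma continuous_pair (Z Y1 Y2 : topologicalType) (g : Z -> Y1) (h : Z -> Y2) :
  continuous g -> continuous h -> continuous (fun z => (g z, h z)).
Proof.
move=> cg ch z; apply: (cvg_pair (G := nbhs (g z)) (H := nbhs (h z))).
  exact: cg.
exact: ch.
Qed.

Lemma continuous_mdist (R : realType) (X : metricType R) (Z : topologicalType)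
    (g h : Z -> X) :
  continuous g -> continuous h -> continuous (fun z => mdist (g z) (h z)).
Proof.
move=> cg ch z0; apply/cvgrPdist_lt => e e0.
have e20 : 0 < e / 2 by rewrite divr_gt0.
have gd := metricType_numDomainType.cvgr_dist_lt (cg z0) e20.
have hd := metricType_numDomainType.cvgr_dist_lt (ch z0) e20.
near=> z.
have gz : mdist (g z0) (g z) < e / 2 by near: z; exact: gd.
have hz : mdist (h z0) (h z) < e / 2 by near: z; exact: hd.
(* Move [g] first and then [h], once from [z0] to [z] and once back; each move costs less than
   [e / 2]. *)
have := metric_triangle (g z0) (g z) (h z0).
have := metric_triangle (g z) (h z) (h z0).
have := metric_triangle (g z) (g z0) (h z).
have := metric_triangle (g z0) (h z0) (h z).
rewrite (metric_sym (h z)) (metric_sym (g z) (g z0)) ltr_norml.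
by move=> *; lra.
Unshelve. all: by end_near. Qed.

Section trajectory_extension.
Context {R : realType}.

Lemma clamp_subproof (T : Rge0 R) (t : R) :
  Num.max 0 (Num.min t (\val T)) \in `[0, \val T].
Proof. by rewrite in_itv/= le_max lexx ge_max Rge0_ge0 ge_min lexx orbT. Qed.

Definition clamp (T : Rge0 R) (t : R) : `[0, \val T]%classic :=
  mkitv (clamp_subproof T t).

Lemma val_clamp (T : Rge0 R) (t : R) :
  0 <= t <= \val T -> \val (clamp T t) = t.
Proof. by move=> /andP[t0 tT] /=; rewrite min_l// max_r. Qed.

(** The codomain of [clamp (T z)] varies with [z], so continuity is stated for the underlying real
    number. *)
Lemma continuous_clamp_val (Z : topologicalType) (T : Z -> Rge0 R)
    (g : Z -> R) : continuous T -> continuous g ->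
  continuous (fun z => \val (clamp (T z) (g z))).
Proof.
move=> cT cg z.
apply: (continuous_max (f := cst 0) (g := fun z => Num.min (g z) (\val (T z)))).
  exact: cvg_cst.
apply: (continuous_min (g := fun z => \val (T z))); first exact: cg.
by apply: (continuous_comp (cT z)); exact: continuous_set_val.
Qed.

Context {X : metricType R}.

(** Also constant before time 0, so that trajectories of different lengths become functions on all
    of [R]. *)
Definition traj_ext (x : trajectory X) (t : R) : X := tfun (clamp (tlen x) t).

Lemma traj_ext_in (x : trajectory X) (t : `[0, \val (tlen x)]%classic) :
  traj_ext x (\val t) = tfun t.
Proof.
congr tfun; apply: val_inj; apply: val_clamp.
by have := itv_in t; rewrite in_itv.
Qed.

Lemma traj_ext_min (x : trajectory X) (t : R) :
  traj_ext x (Num.min t (\val (tlen x))) = traj_ext x t.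
Proof. by congr tfun; apply: val_inj; rewrite /= -minA minxx. Qed.

Lemma continuous_traj_ext (x : trajectory X) : continuous (traj_ext x).
Proof.
move=> t; apply: continuous_comp; last exact: tfun_continuous.
apply: continuous_set_type => {}t.
by apply: continuous_clamp_val => {}t; [exact: cvg_cst|exact: cvg_id].
Qed.

(* Freezing [y] after [tlen x] as well makes the domain of the supremum
   independent of [x]. *)
Lemma traj_distE (x y : trajectory X) :
  traj_dist x y =
  sup [set mdist (traj_ext x t) (traj_ext y (Num.min t (\val (tlen x))))
      | t in `[0, \val (tlen y)]%classic]
  + `|\val (tlen y) - \val (tlen x)|.
Proof.
rewrite /traj_dist; congr (sup _ + _); apply/seteqP; split => [_ [t _ <-]|].
- have := itv_in t; rewrite in_itv/= le_min => /and3P[t0 tx ty].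
  exists (\val t); first by rewrite /= in_itv/= t0.
  by rewrite min_l// -!traj_ext_in.
- move=> _ [t /= + <-]; rewrite in_itv/= => /andP[t0 ty].
  (* A time past the end of [x] contributes the same distance as the end of [x] itself. *)
  have st : Num.min t (\val (tlen x)) \in
      `[0, Num.min (\val (tlen x)) (\val (tlen y))].
    by rewrite in_itv/= !le_min t0 Rge0_ge0 !ge_min lexx ty orbT.
  by exists (mkitv st) => //; rewrite -!traj_ext_in/= traj_ext_min.
Qed.

(** A neighbourhood of [x] contains a finite intersection of subbasic balls containing [x], and
    filters are closed under finite intersections. All centres [y] are considered because, without a
    triangle inequality, one cannot pass from a ball around [y] to a smaller one around [x]. *)
Lemma cvg_trajectory (I : Type) (F : set_system I) (f : I -> trajectory X)
    (x : trajectory X) : Filter F ->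
  (forall y e, traj_dist x y < e -> \forall i \near F, traj_dist (f i) y < e) ->
  f @ F --> x.
Proof.
move=> FF near_f A; rewrite nbhsE => -[_ [[B sB <-] [C BC Ct]] sUBA].
apply: filterS sUBA _; apply: (@filterS _ _ _ C).
  by move=> ? ?; exists C.
have /sB [D sD IDeC] := BC; rewrite -IDeC.
apply: (@filter_bigI _ _ D id) => E DE.
have /sD := DE; rewrite inE => -[y [e [_ EE]]].
rewrite EE; apply: near_f.
by move: Ct; rewrite -IDeC => /(_ _ DE); rewrite EE.
Qed.

(** Joint continuity is local in time; compactness of the domain of each centre [y] makes the
    estimate uniform in time. *)
Lemma continuous_trajectory (Z : topologicalType) (f : Z -> trajectory X) :
  continuous (fun z => tlen (f z)) ->
  continuous (fun zt : Z * R => traj_ext (f zt.1) zt.2) ->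
  continuous f.
Proof.
move=> clen cext z0; apply: cvg_trajectory => y e.
pose k z t :=
  mdist (traj_ext (f z) t) (traj_ext y (Num.min t (\val (tlen (f z))))).
have clen' : continuous (fun z => \val (tlen (f z))).
  by move=> z; apply: (continuous_comp (clen z)); exact: continuous_set_val.
have ck : continuous (fun zt : Z * R => k zt.1 zt.2).
  apply: continuous_mdist => // -[z t].
  apply: (continuous_comp (g := traj_ext y)
    (f := fun zt : Z * R => Num.min zt.2 (\val (tlen (f zt.1)))));
    last exact: continuous_traj_ext.
  apply: (continuous_min (f := snd) (g := fun zt => \val (tlen (f zt.1)))).
    exact: cvg_snd.
  apply: (continuous_comp (f := fst) (g := fun z => \val (tlen (f z)))).
    exact: cvg_fst.
  exact: clen'.
have y0 : [set` `[0, \val (tlen y)]] 0 by rewrite /= in_itv/= lexx Rge0_ge0.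
(* The [sup] of an unbounded set is 0 by default; boundedness is what makes [s] below an upper bound
   of [k z0]. *)
have bounded : has_ubound [set k z0 t | t in [set` `[0, \val (tlen y)]]].
  have : compact (k z0 @` [set` `[0, \val (tlen y)]]).
    apply: continuous_compact; last exact: segment_compact.
    apply: continuous_subspaceT => t.
    apply: (continuous_comp (f := pair z0) (g := fun zt => k zt.1 zt.2));
      last exact: ck.
    by apply: continuous_pair => {}t; [exact: cvg_cst|exact: cvg_id].
  move=> /compact_bounded[M [_ /(_ (M + 1))]]; rewrite ltrDl ltr01.
  move=> /(_ isT) bM.
  by exists (M + 1) => r /bM; exact: le_trans (ler_norm r).
rewrite traj_distE; set s := sup _ => se.
(* Half of the slack: one [d] for the growth of the supremum, one for the change of length. *)
pose d := (e - s - `|\val (tlen y) - \val (tlen (f z0))|) / 2.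
have d0 : 0 < d by rewrite divr_gt0// -addrA -opprD subr_gt0.
have near_k : \forall z \near z0,
    [set` `[0, \val (tlen y)]] `<=` (fun t => k z t < s + d).
  (* Tube lemma: it suffices to find, for each time [t], a neighbourhood of [(t, z0)]. The time
     comes first here, hence [cswap]. *)
  apply: (iffLR (compact_near_coveringP _)); first exact: segment_compact.
  move=> t ty.
  have kt : k z0 t < s + d.
    by rewrite (@le_lt_trans _ _ s) ?ltrDl//; apply: ub_le_sup => //; exists t.
  have cswap : continuous (fun tz : R * Z => (tz.2, tz.1)).
    by apply: continuous_pair => ?; [exact: cvg_snd|exact: cvg_fst].
  have ckt := continuous_comp (cswap (t, z0)) (ck (z0, t)).
  exact: (cvgr_lt _ ckt _ kt).
have near_len : \forall z \near z0,
    `|\val (tlen (f z0)) - \val (tlen (f z))| < d.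
  exact: (cvgr_dist_lt _ _ (clen' z0) _ d0).
near=> z.
have lz : `|\val (tlen (f z0)) - \val (tlen (f z))| < d.
  by near: z; exact: near_len.
have kz : [set` `[0, \val (tlen y)]] `<=` (fun t => k z t < s + d).
  by near: z; exact: near_k.
rewrite traj_distE.
(* Passing to the supremum loses strictness; the final strict inequality comes from [lz]. *)
have : sup [set k z t | t in [set` `[0, \val (tlen y)]]] <= s + d.
  by apply: ge_sup; [exists (k z 0), 0|move=> _ [t ty <-]; exact/ltW/kz].
have := ler_distD (\val (tlen (f z0))) (\val (tlen y)) (\val (tlen (f z))).
by move: lz; rewrite /k /d; lra.
Unshelve. all: by end_near. Qed.

End trajectory_extension.

Section path_action_continuity.
Context {R : realType} {U : Type} {S : set (signal R U)}.
Context {calU : controlSpaceType S}.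

Lemma continuous_cprefix (Z : topologicalType) (g : Z -> calU)
    (h : Z -> Rge0 R) : continuous g -> continuous h ->
  continuous (fun z => cprefix (g z) (h z)).
Proof.
move=> cg ch z.
apply: (continuous_comp (f := fun z => (g z, h z))
  (g := fun ut => cprefix ut.1 ut.2)); first exact: continuous_pair.
exact: (@control_prefix_continuous _ _ _ calU).
Qed.

(** Serves twice: with signal and state fixed, for the continuity of a single trajectory, and with
    everything varying, for that of the whole map. *)
Lemma continuous_path_prefix (X : topologicalType) (p : calU * X -> X)
    (Z : topologicalType) (g : Z -> calU) (h : Z -> Rge0 R) (k : Z -> X) :
  continuous p -> continuous g -> continuous h -> continuous k ->
  continuous (fun z => p (cprefix (g z) (h z), k z)).
Proof.
move=> cp cg ch ck z.
apply: (continuous_comp (f := fun z => (cprefix (g z) (h z), k z)) (g := p));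
  last exact: cp.
by apply: continuous_pair => //; exact: continuous_cprefix.
Qed.

End path_action_continuity.

Theorem corollary3p15 (R : realType) (U : Type) (U_neq0 : inhabited U)
    (S : set (signal R U)) (calU : controlSpaceType S)
    (X : metricType R) (X_polish : polish_metric X)
    (p : calU * X -> X) (p_action : path_action p) :
  exists pbar_cont : forall (u : calU) (x : X),
      continuous (path_trajectory p u x),
    continuous (fun ux : calU * X =>
      Trajectory (pbar_cont ux.1 ux.2)).
Proof.
have [cp _ _] := p_action.
have pbar_cont (u : calU) (x : X) : continuous (path_trajectory p u x).
  apply: (@continuous_path_prefix _ _ _ _ _ p _ (fun=> u) _ (fun=> x)) => //.
  - exact: cst_continuous.
  - by apply: continuous_set_type; exact: continuous_set_val.
  - exact: cst_continuous.
exists pbar_cont.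
have clen : continuous (fun ux : calU * X => clen ux.1).
  move=> ux; apply: continuous_comp; first exact: cvg_fst.
  exact: (@control_len_continuous _ _ _ calU).
have cfst : continuous (fun uxt : calU * X * R => uxt.1).
  by move=> uxt; exact: cvg_fst.
apply: continuous_trajectory => //=.
(* By conversion, the extended trajectory is [p] applied to the prefix at the clamped time. *)
apply: (@continuous_path_prefix _ _ _ _ _ p _ (fun uxt : calU * X * R => uxt.1.1)
  _ (fun uxt => uxt.1.2)) => //.
- by move=> uxt; apply: (continuous_comp (cfst uxt)); exact: cvg_fst.
- apply: continuous_set_type; apply: continuous_clamp_val.
  + by move=> uxt; exact: (continuous_comp (cfst uxt) (clen uxt.1)).
  + by move=> uxt; exact: cvg_snd.
- by move=> uxt; apply: (continuous_comp (cfst uxt)); exact: cvg_snd.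
Qed.
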